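(* Let $(G,T,\ell,u,w)$ be a PESP instance with $G=(V,A)$, let $\mathcal P$ and $\mathcal P_{\mathrm{flip}}$ be its fractional periodic timetabling polytope and its flip polytope (with respect to some integral cycle basis), let $(x,z)\in\mathcal P\setminus\mathcal P_{\mathrm{flip}}$ and $\alpha\in\{1,\dots,T-1\}$. Then a maximally violated flip inequality with respect to $(x,z)$ with $\alpha_{\gamma,F}=\alpha$ among all oriented cycles $\gamma$ and all $F\subseteq A$ is found by the following integer program in the variables $f^+,f^-,y^+,y^-,\gamma,k$: $$\begin{aligned}\text{minimize}\quad &(T-\alpha)\sum_{a\in A}(x_a-\ell_a)y_a^+ +\alpha\sum_{a\in A}(x_a-\ell_a)y_a^- +\alpha\sum_{a\in A}(u_a-x_a)f_a^+ +(T-\alpha)\sum_{a\in A}(u_a-x_a)f_a^-\\ \text{s.t.}\quad &\sum_{a\in A}\ell_a(y_a^--y_a^+)+\sum_{a\in A}u_a(f_a^--f_a^+)+kT=\alpha,\\ &\sum_{a\in\delta^+(v)}\gamma_a-\sum_{a\in\delta^-(v)}\gamma_a=0\quad (v\in V),\\ &f^+-f^-+y^+-y^-=\gamma,\\ &0\le f^++f^-+y^++y^-\le 1,\\ &f^+,f^-,y^+,y^-\in\{0,1\}^A,\quad \gamma\in\{-1,0,1\}^A,\quad k\in\mathbb Z.\end{aligned}$$ That is, if there is any pair of an oriented cycle $\gamma'$ and $F'\subseteq A$ with $\alpha_{\gamma',F'}=\alpha$, then the integer program has an optimal solution, and for every optimal solution the pair consisting of $\gamma$ and $F=\{a\in A\mid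 f_a^++f_a^-=1\}$ satisfies $\alpha_{\gamma,F}=\alpha$ and maximizes the violation (right-hand side minus left-hand side of the flip inequality at $(x,z)$) among all pairs $(\gamma',F')$ of an oriented cycle $\gamma'$ and a set $F'\subseteq A$ with $\alpha_{\gamma',F'}=\alpha$.
   Context: A PESP instance $(G,T,\ell,u,w)$ consists of a finite weakly connected directed graph $G=(V,A)$, a period $T\in\mathbb N$, $T\ge 2$, bounds $\ell,u\in\mathbb Z^A$ and weights $w\in\mathbb R^A$. The cycle space is $\mathcal C=\{\gamma\in\mathbb Z^A \mid \sum_{a\in\delta^+(i)}\gamma_a=\sum_{a\in\delta^-(i)}\gamma_a\ \forall i\in V\}$, of rank $\mu=|A|-|V|+1$. An oriented cycle is an element of $\mathcal C\cap\{-1,0,1\}^A$. An integral cycle basis is a set $B$ of $\mu$ oriented cycles forming a $\mathbb Z$-basis of $\mathcal C$; its cycle matrix $\Gamma\in\{-1,0,1\}^{B\times A}$ has the elements of $B$ as rows. The fractional periodic timetabling polytope is $\mathcal P=\{(x,z)\in\mathbb R^A\times\mathbb R^B\mid \Gamma x=Tz,\ \ell\le x\le u\}$. $[y]_T\in[0,T)$ denotes $y$ modulo $T$. For $\gamma\in\mathcal C$, $F\subseteq A$ set $\alpha_{\gamma,F}=[-\sum_{a\in A\setminus F}\gamma_a\ell_a-\sum_{a\in F}\gamma_a u_a]_T$. The flip inequality for $(\gamma,F)$ is $$(T-\alpha_{\gamma,F})\sum_{a\in A\setminus F,\gamma_a>0}\gamma_a(x_a-\ell_a)+\alpha_{\gamma,F}\sum_{a\in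 A\setminus F,\gamma_a<0}(-\gamma_a)(x_a-\ell_a)+\alpha_{\gamma,F}\sum_{a\in F,\gamma_a>0}\gamma_a(u_a-x_a)+(T-\alpha_{\gamma,F})\sum_{a\in F,\gamma_a<0}(-\gamma_a)(u_a-x_a)\ \ge\ \alpha_{\gamma,F}(T-\alpha_{\gamma,F}).$$ $\mathcal P_{\mathrm{flip}}$ is the set of $(x,z)\in\mathcal P$ satisfying the flip inequality for all $\gamma\in\mathcal C$, $F\subseteq A$. *)

(* Defs.v *)
From HB Require Import structures.
From mathcomp Require Import all_boot all_order all_algebra.
From mathcomp Require Import finmap reals.

Set Implicit Arguments.
Unset Strict Implicit.
Unset Printing Implicit Defensive.

Import Order.TTheory GRing.Theory Num.Theory.
Local Open Scope ring_scope.

(* Parallel arcs and loops are allowed. *)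
Record digraph := Digraph {
  dvertex : finType;
  darc : finType;
  source : darc -> dvertex;
  target : darc -> dvertex
}.

Definition adjacent (G : digraph) : rel (dvertex G) := fun v w =>
  [exists a : darc G, ((source a == v) && (target a == w))
                     || ((source a == w) && (target a == v))].

Definition weakly_connected (G : digraph) : Prop :=
  forall v w : dvertex G, connect (@adjacent G) v w.

Record pesp (R : realType) := Pesp {
  graph :> digraph;
  period : nat;
  lower : darc graph -> int;
  upper : darc graph -> int;
  weight : darc graph -> R;
  graph_connected : weakly_connected graph;
  period_ge2 : (2 <= period)%N
}.

(* An int, since subtraction on nat is truncated. *)
Definition cyclomatic_number (G : digraph) : int :=
  #|darc G|%:Z - #|dvertex G|%:Z + 1.

Definition in_cycle_space (G : digraph) (g : {ffun darc G -> int}) : Prop :=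
  forall v : dvertex G,
    \sum_(a : darc G | source a == v) g a = \sum_(a : darc G | target a == v) g a.

Definition oriented_cycle (G : digraph) (g : {ffun darc G -> int}) : Prop :=
  in_cycle_space g /\ (forall a : darc G, g a \in [:: -1; 0; 1]).

Definition integral_cycle_basis (G : digraph)
    (B : {fset {ffun darc G -> int}}) : Prop :=
  [/\ #|` B|%:Z = cyclomatic_number G,
      forall g, g \in B -> oriented_cycle g &
      forall g, in_cycle_space g ->
        exists! c : {ffun B -> int}, g = \sum_(b : B) fsval b *~ c b].

Definition cycle_matrix (G : digraph) (B : {fset {ffun darc G -> int}})
    (b : B) (a : darc G) : int := fsval b a.

Section Polytopes.
Variables (R : realType) (I : pesp R).
Implicit Types (g : {ffun darc I -> int}) (F : {set darc I}) (x : darc I -> R).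

Local Notation T := (period I).
Local Notation l := (@lower R I).
Local Notation u := (@upper R I).

Definition frac_polytope (B : {fset {ffun darc I -> int}})
    x (z : B -> R) : Prop :=
  (forall b : B, \sum_(a : darc I) (cycle_matrix b a)%:~R * x a = T%:R * z b) /\
  (forall a : darc I, (l a)%:~R <= x a <= (u a)%:~R).

Definition flip_alpha g F : int :=
  ((- \sum_(a in ~: F) g a * l a - \sum_(a in F) g a * u a) %% T%:Z)%Z.

Definition flip_lhs g F x : R :=
  let al : R := (flip_alpha g F)%:~R in
    (T%:R - al) * \sum_(a in ~: F | 0 < g a) (g a)%:~R * (x a - (l a)%:~R)
  + al * \sum_(a in ~: F | g a < 0) (- g a)%:~R * (x a - (l a)%:~R)
  + al * \sum_(a in F | 0 < g a) (g a)%:~R * ((u a)%:~R - x a)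
  + (T%:R - al) * \sum_(a in F | g a < 0) (- g a)%:~R * ((u a)%:~R - x a).

Definition flip_rhs g F : R :=
  let al : R := (flip_alpha g F)%:~R in al * (T%:R - al).

Definition flip_inequality g F x : Prop := flip_lhs g F x >= flip_rhs g F.

Definition flip_violation g F x : R := flip_rhs g F - flip_lhs g F x.

Definition flip_polytope (B : {fset {ffun darc I -> int}})
    x (z : B -> R) : Prop :=
  frac_polytope x z /\ (forall g F, in_cycle_space g -> flip_inequality g F x).

End Polytopes.

Record ip_point (G : digraph) := IPPoint {
  ip_fp : {ffun darc G -> int};
  ip_fm : {ffun darc G -> int};
  ip_yp : {ffun darc G -> int};
  ip_ym : {ffun darc G -> int};
  ip_gamma : {ffun darc G -> int};
  ip_k : int
}.

Section IntegerProgram.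
Variables (R : realType) (I : pesp R) (alpha : int) (x : darc I -> R).
Implicit Type s : ip_point I.

Local Notation T := (period I).
Local Notation l := (@lower R I).
Local Notation u := (@upper R I).

Definition ip_objective s : R :=
    (T%:R - alpha%:~R) * \sum_(a : darc I) (x a - (l a)%:~R) * (ip_yp s a)%:~R
  + alpha%:~R * \sum_(a : darc I) (x a - (l a)%:~R) * (ip_ym s a)%:~R
  + alpha%:~R * \sum_(a : darc I) ((u a)%:~R - x a) * (ip_fp s a)%:~R
  + (T%:R - alpha%:~R) * \sum_(a : darc I) ((u a)%:~R - x a) * (ip_fm s a)%:~R.

Definition ip_feasible s : Prop :=
  [/\ \sum_(a : darc I) l a * (ip_ym s a - ip_yp s a)
        + \sum_(a : darc I) u a * (ip_fm s a - ip_fp s a)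
        + ip_k s * T%:Z = alpha,
      forall v : dvertex I,
        \sum_(a : darc I | source a == v) ip_gamma s a
          - \sum_(a : darc I | target a == v) ip_gamma s a = 0,
      forall a, ip_fp s a - ip_fm s a + ip_yp s a - ip_ym s a = ip_gamma s a,
      forall a, 0 <= ip_fp s a + ip_fm s a + ip_yp s a + ip_ym s a <= 1 &
      forall a, [/\ ip_fp s a \in [:: 0; 1], ip_fm s a \in [:: 0; 1],
                    ip_yp s a \in [:: 0; 1], ip_ym s a \in [:: 0; 1] &
                    ip_gamma s a \in [:: -1; 0; 1]]].

Definition ip_optimal s : Prop :=
  ip_feasible s /\ (forall s', ip_feasible s' -> ip_objective s <= ip_objective s').

End IntegerProgram.

Definition ip_flip_set (G : digraph) (s : ip_point G) : {set darc G} :=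
  [set a | ip_fp s a + ip_fm s a == 1].

(* Main.v *)
(* Feasible points of the integer program are, up to [k], the pairs of an
   oriented cycle and a flip set with [flip_alpha] equal to [alpha]: an arc with
   nonzero [gamma] activates exactly one of the four indicators, selected by its
   sign and by its membership in the flip set. Under this correspondence the
   objective is the left-hand side of the flip inequality, whose right-hand side
   is the constant [alpha * (T - alpha)]; so minimizing the objective maximizes
   the violation, and optima exist since there are finitely many pairs. *)
Require Import Defs.
From HB Require Import structures.
From mathcomp Require Import all_boot all_order all_algebra.
From mathcomp Require Import finmap reals.
From mathcomp Require Import zify.

Set Implicit Arguments.
Unset Strict Implicit.
Unset Printing Implicit Defensive.

Import Order.TTheory GRing.Theory Num.Theory.
Local Open Scope ring_scope.

Section FlipPoints.
Variables (R : realType) (I : pesp R).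
Implicit Types (g : {ffun darc I -> int}) (F : {set darc I}) (x : darc I -> R).
Implicit Type s : ip_point I.

Local Notation T := (period I).
Local Notation l := (@lower R I).
Local Notation u := (@upper R I).

(** Taking [ip_k] to be the negated quotient turns the first constraint into
    [m - (m %/ T) * T = m %% T], with [m] the integer reduced in [flip_alpha]. *)
Definition ip_of_flip g F : ip_point I :=
  {| ip_fp := [ffun a => ((a \in F) && (0 < g a))%:Z];
     ip_fm := [ffun a => ((a \in F) && (g a < 0))%:Z];
     ip_yp := [ffun a => ((a \notin F) && (0 < g a))%:Z];
     ip_ym := [ffun a => ((a \notin F) && (g a < 0))%:Z];
     ip_gamma := g;
     ip_k := - ((- \sum_(a in ~: F) g a * l a - \sum_(a in F) g a * u a)
                  %/ T%:Z)%Z |}.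

(** As the entries of [g] are signs, [ip_ym - ip_yp] is [- g] off [F] and 0 on [F], while
    [ip_fm - ip_fp] is [- g] on [F] and 0 off [F]. *)
Lemma sum_ip_of_flip g F : (forall a, g a \in [:: -1; 0; 1]) ->
  \sum_a l a * (ip_ym (ip_of_flip g F) a - ip_yp (ip_of_flip g F) a)
    + \sum_a u a * (ip_fm (ip_of_flip g F) a - ip_fp (ip_of_flip g F) a)
  = - \sum_(a in ~: F) g a * l a - \sum_(a in F) g a * u a.
Proof.
move=> hg; rewrite -!sumrN; congr (_ + _).
  rewrite [RHS]big_mkcond; apply: eq_bigr => a _; rewrite !ffunE inE.
  by have := hg a; rewrite !inE => /or3P[] /eqP ->; case: (a \in F) => /=; lia.
rewrite [RHS]big_mkcond; apply: eq_bigr => a _; rewrite !ffunE.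
by have := hg a; rewrite !inE => /or3P[] /eqP ->; case: (a \in F) => /=; lia.
Qed.

Lemma ip_of_flip_feasible g F :
  oriented_cycle g -> ip_feasible (flip_alpha g F) (ip_of_flip g F).
Proof.
move=> [hc hg]; split.
- rewrite sum_ip_of_flip // /flip_alpha /=.
  set m := (X in X + _ = _); rewrite {1}(divz_eq m T) mulNr.
  by rewrite addrAC subrr add0r.
- by move=> v /=; rewrite hc subrr.
- move=> a; rewrite !ffunE /=.
  by have := hg a; rewrite !inE => /or3P[] /eqP ->; case: (a \in F).
- move=> a; rewrite !ffunE /=.
  by have := hg a; rewrite !inE => /or3P[] /eqP ->; case: (a \in F).
- by move=> a; rewrite !ffunE /= hg; do 4!case: (_ && _).
Qed.

(** Every coefficient [g a] or [- g a] surviving in the four sums is 1, the value of the matching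
    indicator. *)
Lemma ip_of_flip_objective g F x : (forall a, g a \in [:: -1; 0; 1]) ->
  ip_objective (flip_alpha g F) x (ip_of_flip g F) = flip_lhs g F x.
Proof.
move=> hg; rewrite /ip_objective /flip_lhs.
congr (_ * _ + _ * _ + _ * _ + _ * _); rewrite [RHS]big_mkcond;
  apply: eq_bigr => a _; rewrite !ffunE ?inE mulrC.
all: have := hg a; rewrite !inE => /or3P[] /eqP ->.
all: by case: (a \in F); rewrite /= ?mul0r.
Qed.

Lemma ip_feasible_oriented_cycle alpha s :
  ip_feasible alpha s -> oriented_cycle (ip_gamma s).
Proof.
case=> _ hc _ _ hi; split=> [v|a]; last by case: (hi a).
by apply/eqP; rewrite -subr_eq0 hc.
Qed.

(* Since at most one of the four indicators of an arc is 1, the sign of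
   [gamma a] and the membership of [a] in the flip set determine all of them. *)
Lemma ip_feasibleE alpha s (s' := ip_of_flip (ip_gamma s) (ip_flip_set s)) :
  ip_feasible alpha s ->
  [/\ ip_fp s = ip_fp s', ip_fm s = ip_fm s', ip_yp s = ip_yp s'
    & ip_ym s = ip_ym s'].
Proof.
case=> _ _ hg h1 hi; rewrite /s'.
split; apply/ffunP => a; rewrite ffunE inE -hg; have := h1 a;
  case: (hi a); rewrite !inE.
all: by do 4!(move=> /orP[] /eqP ->).
Qed.

(** The first constraint gives congruence to [alpha] modulo [T]; the bounds make [alpha] its own
    residue. *)
Lemma ip_feasible_flip_alpha alpha s : 0 <= alpha < T%:Z ->
  ip_feasible alpha s -> flip_alpha (ip_gamma s) (ip_flip_set s) = alpha.
Proof.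
move=> alphaT hs.
have [_ hg] := ip_feasible_oriented_cycle hs.
have [efp efm eyp eym] := ip_feasibleE hs.
have [+ _ _ _ _] := hs; rewrite efp efm eyp eym sum_ip_of_flip // => hk.
rewrite -[RHS](modz_small (m := alpha) (d := T%:Z)) //.
by rewrite /flip_alpha -[in RHS]hk [X in _ = (X %% _)%Z]addrC modzMDl.
Qed.

(** The objective reads only the four indicators, which [s] shares with the point built from its
    pair. *)
Lemma ip_feasible_objective alpha s x : 0 <= alpha < T%:Z ->
  ip_feasible alpha s ->
  ip_objective alpha x s = flip_lhs (ip_gamma s) (ip_flip_set s) x.
Proof.
move=> alphaT hs; have [_ hg] := ip_feasible_oriented_cycle hs.
have [efp efm eyp eym] := ip_feasibleE hs.
rewrite -ip_of_flip_objective // (ip_feasible_flip_alpha alphaT hs).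
by rewrite /ip_objective {1}efp {1}efm {1}eyp {1}eym.
Qed.

(** Pairs of arc sets form a finite type, unlike integer-valued functions, so a minimum over sign
    vectors can be taken through this encoding. Overlapping sets are harmless: common arcs get 0. *)
Definition sign_vector (PN : {set darc I} * {set darc I}) :
    {ffun darc I -> int} :=
  [ffun a => (a \in PN.1)%:Z - (a \in PN.2)%:Z].

Lemma sign_vector_surj g : (forall a, g a \in [:: -1; 0; 1]) ->
  exists PN, g = sign_vector PN.
Proof.
move=> hg; exists ([set a | g a == 1], [set a | g a == -1]).
apply/ffunP => a; rewrite ffunE !inE.
by have := hg a; rewrite !inE => /or3P[] /eqP ->.
Qed.

Lemma flip_lhs_min alpha x :
  (exists g F, oriented_cycle g /\ flip_alpha g F = alpha) ->
  exists g F, [/\ oriented_cycle g, flip_alpha g F = alpha &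
    forall g' F', oriented_cycle g' -> flip_alpha g' F' = alpha ->
      flip_lhs g F x <= flip_lhs g' F' x].
Proof.
move=> [g0 [F0 [[hc0 hg0] ha0]]].
have [PN0 e0] := sign_vector_surj hg0.
pose P (i : {set darc I} * {set darc I} * {set darc I}) :=
  [&& [forall v, \sum_(a | source a == v) sign_vector i.1 a
                  == \sum_(a | target a == v) sign_vector i.1 a],
      [forall a, sign_vector i.1 a \in [:: -1; 0; 1]] &
      flip_alpha (sign_vector i.1) i.2 == alpha].
have PP i : reflect (oriented_cycle (sign_vector i.1) /\
    flip_alpha (sign_vector i.1) i.2 = alpha) (P i).
  apply: (iffP and3P) => [[/forallP hc /forallP hg /eqP ha]|[[hc hg] ha]].
    by split=> //; split=> // v; apply/eqP.
  by split; [apply/forallP => v; apply/eqP/hc | apply/forallP | apply/eqP].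
have P0 : P (PN0, F0) by apply/PP; rewrite /= -e0.
(* The encoded candidates are finite in number, and [P0] shows that there is one. *)
case: (Order.TotalTheory.arg_minP (fun i => flip_lhs (sign_vector i.1) i.2 x) P0).
move=> -[PN F] /PP[/= hPN ha] hmin.
exists (sign_vector PN), F; split=> // g' F' hg' ha'.
have [PN' e'] := sign_vector_surj hg'.2.
by rewrite e'; apply: (hmin (PN', F')); apply/PP; rewrite /= -e'.
Qed.

End FlipPoints.

Theorem theorem4p5 (R : realType) (I : pesp R)
    (B : {fset {ffun darc I -> int}}) (hB : integral_cycle_basis B)
    (x : darc I -> R) (z : B -> R)
    (hP : frac_polytope x z) (hflip : ~ flip_polytope x z)
    (alpha : int) (halpha : 1 <= alpha <= (period I)%:Z - 1)
    (hex : exists (g' : {ffun darc I -> int}) (F' : {set darc I}),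
        oriented_cycle g' /\ flip_alpha g' F' = alpha) :
  (exists s : ip_point I, ip_optimal alpha x s) /\
  (forall s : ip_point I, ip_optimal alpha x s ->
     [/\ oriented_cycle (ip_gamma s),
         flip_alpha (ip_gamma s) (ip_flip_set s) = alpha &
         forall (g' : {ffun darc I -> int}) (F' : {set darc I}),
           oriented_cycle g' -> flip_alpha g' F' = alpha ->
           flip_violation g' F' x
             <= flip_violation (ip_gamma s) (ip_flip_set s) x]).
Proof.
have alphaT : 0 <= alpha < (period I)%:Z by move: halpha; lia.
split.
  have [g [F [hg ha hmin]]] := flip_lhs_min x hex.
  exists (ip_of_flip g F); split; first by rewrite -ha; apply: ip_of_flip_feasible.
  move=> s' hs'; rewrite (ip_feasible_objective x alphaT hs').
  rewrite -[X in ip_objective X]ha ip_of_flip_objective; last exact: hg.2.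
  apply: hmin; first exact: ip_feasible_oriented_cycle hs'.
  exact: ip_feasible_flip_alpha.
move=> s [hs hmin].
have ha := ip_feasible_flip_alpha alphaT hs.
split=> //; first exact: ip_feasible_oriented_cycle hs.
(* Equal residues give equal right-hand sides, so only the left-hand sides remain to be compared, in
   reverse order. *)
move=> g' F' hg' ha'; rewrite /flip_violation /flip_rhs ha ha' lerD2l lerN2.
rewrite -(ip_feasible_objective x alphaT hs) -ip_of_flip_objective; last exact: hg'.2.
by rewrite ha'; apply: hmin; rewrite -ha'; apply: ip_of_flip_feasible.
Qed.
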